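(* Let $p$ be a prime number and $G$ a cyclic group of order $p$ generated by $\alpha$. Let $0\neq f\in\mathbb{C}^G$ and let $\widehat{f}\in\mathbb{C}^{\widehat{G}}$ be the Fourier transform of $f$. Let $\tilde f(z)=\sum_{i=0}^{p-1}f(\alpha^i)z^i\in\mathbb{C}[z]$. Then $$|\mathrm{supp}(f)|+|\mathrm{supp}(\widehat{f}\,)|\;\ge\;p+1,$$ with equality if and only if $\deg\big(\gcd(\tilde f(z),z^p-1)\big)=|\mathrm{supp}(f)|-1$.
   Context: $\mathbb{C}^G$ is the space of functions $G\to\mathbb{C}$. $\widehat{G}=\mathrm{Irr}(G)$ is the group of characters (homomorphisms $G\to\mathbb{C}^\times$), and $\widehat{f}(\psi)=\sum_{x\in G}f(x)\psi(x)$ for $\psi\in\widehat{G}$. The support of a function is the set of points where it is nonzero. The gcd is taken in $\mathbb{C}[z]$. *)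

(* Defs.v *)
From HB Require Import structures.
From mathcomp Require Import all_boot all_order all_fingroup all_algebra all_solvable.
From mathcomp Require Import reals complex.

Set Implicit Arguments.
Unset Strict Implicit.
Unset Printing Implicit Defensive.

Import Order.TTheory GRing.Theory Num.Theory.
Local Open Scope ring_scope.

Section Dual.
Variables (C : numClosedFieldType) (G : finGroupType).

(* Homomorphisms from G to the multiplicative group of C. *)
Definition is_hom (psi : {ffun G -> C}) : bool :=
  [forall x, psi x != 0] && [forall x, forall y, psi (x * y)%g == psi x * psi y].

Record dual := Dual { dual_val : {ffun G -> C}; dual_hom : is_hom dual_val }.

HB.instance Definition _ := [isSub for dual_val].
HB.instance Definition _ := [Choice of dual by <:].

Definition dual_fun (psi : dual) : G -> C := dual_val psi.
Coercion dual_fun : dual >-> Funclass.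

Lemma dual_neq0 (psi : dual) x : psi x != 0.
Proof. by case/andP: (dual_hom psi) => /forallP/(_ x). Qed.

Lemma dualM (psi : dual) x y : psi (x * y)%g = psi x * psi y.
Proof. by case/andP: (dual_hom psi) => _ /forallP/(_ x)/forallP/(_ y)/eqP. Qed.

Lemma dual1 (psi : dual) : psi 1%g = 1.
Proof. by apply: (mulfI (dual_neq0 psi 1%g)); rewrite -dualM mulg1 mulr1. Qed.

Lemma dualX (psi : dual) x n : psi (x ^+ n)%g = psi x ^+ n.
Proof. by elim: n => [|n IHn]; rewrite ?dual1 // expgS dualM IHn exprS. Qed.

(* There are only finitely many characters: their values are roots of
   'X^#|G| - 1. *)
Definition dual_roots : seq C :=
  sval (closed_field_poly_normal ('X^#|G| - 1 : {poly C})).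

Lemma dual_rootsP (psi : dual) x : psi x \in dual_roots.
Proof.
have G0 : (0 < #|G|)%N by apply/card_gt0P; exists 1%g.
rewrite /dual_roots; case: closed_field_poly_normal => r /= Dr.
have : root ('X^#|G| - 1) (psi x).
  rewrite rootE !hornerE -dualX -cardsT expg_cardG ?inE //.
  by rewrite dual1 subrr.
rewrite Dr (monicP (monicXnsubC 1 G0)).
by rewrite scale1r root_prod_XsubC.
Qed.

Definition dual_enc (psi : dual) : {ffun G -> seq_sub dual_roots} :=
  [ffun x => SeqSub (dual_rootsP psi x)].

Definition dual_dec (g : {ffun G -> seq_sub dual_roots}) : option dual :=
  insub [ffun x => val (g x)].

Lemma dual_encK : pcancel dual_enc dual_dec.
Proof.
move=> psi; rewrite /dual_dec.
have -> : [ffun x => val (dual_enc psi x)] = val psi.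
  by apply/ffunP=> x; rewrite !ffunE.
exact: valK.
Qed.

HB.instance Definition _ := Countable.copy dual (pcan_type dual_encK).
HB.instance Definition _ : isFinite dual := PCanIsFinite dual_encK.

Definition fourier (f : {ffun G -> C}) : {ffun dual -> C} :=
  [ffun psi : dual => \sum_(x : G) f x * psi x].

Definition genpoly (p : nat) (alpha : G) (f : {ffun G -> C}) : {poly C} :=
  \sum_(i < p) f (alpha ^+ i)%g *: 'X^i.

End Dual.

(* Main.v *)
Require Import Defs.
From mathcomp Require Import all_boot all_order all_fingroup all_algebra all_solvable.
From mathcomp Require Import separable cyclotomic.
From mathcomp Require Import reals complex.

Set Implicit Arguments.
Unset Strict Implicit.
Unset Printing Implicit Defensive.

Import Order.TTheory GRing.Theory Num.Theory.
Local Open Scope ring_scope.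

(* Let s = |supp f|.  Characters of G correspond to the p-th roots of unity via
   psi |-> psi(alpha), and fourier f psi is the value of the generating
   polynomial g at psi(alpha).  Hence deg gcd(g, X^p - 1) is the number of zeros
   of the Fourier transform, and everything reduces to Chebotarev's theorem in
   the form: a nonzero polynomial q of degree < p with s terms has fewer than s
   zeros among the p-th roots of unity.

   Suppose q = \sum_(a in S) q_a X^a has zeros zeta^(b_0), ..., zeta^(b_(s-1)).
   Its first s Newton coefficients (divided differences) at these nodes vanish,
   so the matrix of the Newton coefficients of the X^a, a in S, is singular.
   Its determinant is E(zeta) for some E in Z[X], and E(zeta) = 0 forces
   p | E(1), because X^p - 1 = (X - 1)^p modulo p.  But E(1) mod p is the
   same determinant with all nodes equal to 1, so over F_p there is a
   nonzero polynomial of degree < p, supported in S, divisible by (X - 1)^s;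
   an induction on s with the operators h |-> X h' - i h shows that there is none. *)

(** * Integer polynomials at roots of unity, and reduction modulo p *)

Lemma Fp_root1_of_root_unity (C : numFieldType) (p : nat) (E : {poly int})
    (z : C) :
  prime p -> z ^+ p = 1 -> root (map_poly intr E) z ->
  root (map_poly intr E : {poly 'F_p}) 1.
Proof.
move=> p_pr zp1 Ez; have p_gt0 := prime_gt0 p_pr.
pose Xp1 (A : nzRingType) : {poly A} := 'X^p - 1.
have mapX (A B : nzRingType) (h : {rmorphism A -> B}) :
  map_poly h (Xp1 A) = Xp1 B.
  by rewrite rmorphB rmorph1 /= map_polyXn.
(* A nonconstant primitive common factor of E and X^p - 1 reduces to a power
   of X - 1 modulo p. *)
pose D := gcdp (map_poly intr E) (Xp1 rat).
have Dz : root (map_poly ratr D) z.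
  rewrite gcdp_map root_gcd mapX -map_poly_comp /=.
  rewrite (eq_map_poly (g := intr)); last by move=> x /=; rewrite ratr_int.
  by rewrite Ez rootE !hornerE zp1 subrr.
have D0 : D != 0.
  by rewrite gcdp_eq0 negb_and (monic_neq0 (monic_Xn_sub_1 _ p_gt0)) orbT.
have D1 : (1 < size D)%N.
  rewrite -(size_map_poly (@ratr C)); apply: root_size_gt1 Dz.
  by rewrite map_poly_eq0.
have [d [a a0 Dd]] := rat_poly_scale D.
have dD : map_poly intr d %= D.
  by rewrite Dd eqp_sym eqp_scale // invr_eq0 intr_eq0.
(* Gauss's lemma turns divisibility over [rat] into integer factorizations by [zprimitive d]. *)
have /dvdpP_int[r Er] : d %| E.
  by rewrite -dvdp_rat_int (eqp_dvdl _ dD) dvdp_gcdl.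
have /dvdpP_int[s Es] : d %| Xp1 int.
  by rewrite -dvdp_rat_int (eqp_dvdl _ dD) mapX dvdp_gcdr.
set d' := zprimitive d in Er Es.
have d1 : (1 < size d')%N.
  have inj_Q : injective (intr : int -> rat) by exact: intr_inj.
  by rewrite size_zprimitive -(size_map_inj_poly inj_Q) ?rmorph0 ?(eqp_size dD).
pose F := 'F_p.
(* The leading coefficient of [d'] divides that of X^p - 1, which is 1, so reduction modulo p keeps
   the degree. *)
have sz_d : size (map_poly intr d' : {poly F}) = size d'.
  apply: size_map_poly_id0; apply/negP=> /eqP d'0.
  have /(congr1 (intr : int -> F)) := congr1 lead_coef Es.
  rewrite lead_coefM rmorphM /= d'0 mul0r (monicP (monic_Xn_sub_1 _ p_gt0)).
  by move/eqP; rewrite rmorph1 oner_eq0.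
have : (map_poly intr d' : {poly F}) %| ('X - 1%:P) ^+ p.
  have pcharFp : p \in [pchar {poly F}].
    by rewrite (rmorph_pchar polyC) ?pchar_Fp.
  rewrite -(pFrobenius_autE pcharFp) pFrobenius_autB_comm; last exact: mulrC.
  rewrite !pFrobenius_autE -polyC_exp expr1n -[X in _ %| X](mapX int F intr) Es.
  by rewrite rmorphM /= dvdp_mulr.
case/dvdp_exp_XsubCP=> k _ dk.
rewrite Er rmorphM /= rootM (eqp_root dk) orbC.
have : size (('X - 1%:P : {poly F}) ^+ k) = size d'.
  by rewrite -sz_d (eqp_size dk).
case: k {dk} => [|k].
  by rewrite expr0 size_poly1 => Ed; rewrite -Ed in d1.
by move=> _; rewrite root_exp_XsubC eqxx orbT.
Qed.

(** * Sparse polynomials in characteristic p *)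

Lemma eqr_natr_pchar (F : nzRingType) (p i j : nat) :
  p \in [pchar F] -> (i%:R == j%:R :> F) = (i == j %[mod p]).
Proof.
move=> pcharF; wlog le_ji : i j / (j <= i)%N => [W|].
  by case/orP: (leq_total j i) => /W // Wji; rewrite eq_sym Wji eq_sym.
by rewrite eqn_mod_dvd // (dvdn_pcharf pcharF) natrB // subr_eq0.
Qed.

Lemma sparse_XsubC1_exp (F : fieldType) (p k : nat) (g : {poly F}) :
  p \in [pchar F] -> (size g <= p)%N ->
  (#|[set i : 'I_p | (g`_i != 0)%R]| <= k)%N -> ('X - 1%:P) ^+ k %| g -> g = 0.
Proof.
move=> pcharF; elim: k g => [|k IHk] g sz_g.
  rewrite leqn0 cards_eq0 => /eqP g0 _; apply/polyP=> i; rewrite coef0.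
  have [lt_ip|le_pi] := ltnP i p; last by rewrite nth_default ?(leq_trans sz_g).
  by have /setP/(_ (Ordinal lt_ip)) := g0; rewrite !inE => /negbFE/eqP.
move=> card_g dv_g.
have [i gi|g0] := pickP [pred i : 'I_p | g`_i != 0]; last first.
  apply: IHk; rewrite ?(dvdp_trans _ dv_g) ?exprS ?dvdp_mull //.
  by rewrite eq_card0 // => i; rewrite inE [_ != _]g0.
(* [h] loses the monomial of degree i and only one factor [X - 1]. *)
pose h := 'X * g^`() - i%:R *: g.
have coef_h j : h`_j = (j%:R - i%:R) * g`_j.
  rewrite coefB coefZ coefXM coef_deriv mulrBl.
  by case: j => [|j] /=; [rewrite mul0r | rewrite [j.+1%:R * _]mulr_natl].
have h0 : h = 0.
  apply: IHk.
  - apply/leq_sizeP=> j le_pj; rewrite coef_h nth_default ?mulr0 //.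
    exact: leq_trans le_pj.
  - rewrite -ltnS (leq_trans _ card_g) //.
    rewrite (cardsD1 i [set i : 'I_p | (g`_i != 0)%R]) inE [_ != 0]gi ltnS.
    apply: subset_leq_card; apply/subsetP=> j.
    rewrite !inE coef_h mulf_eq0 negb_or => /andP[ji ->]; rewrite andbT.
    by apply: contraNneq ji => ->; rewrite subrr.
  have dvk : ('X - 1%:P : {poly F}) ^+ k %| ('X - 1%:P) ^+ k.+1.
    by rewrite exprS dvdp_mull.
  case/dvdpP: dv_g => u Eg; apply: dvdp_sub; last first.
    by rewrite -mul_polyC Eg !dvdp_mull.
  apply: dvdp_mull; rewrite Eg derivM deriv_exp /=; apply: dvdp_add.
    exact: dvdp_mull.
  by apply: dvdp_mull; rewrite -mulr_natl; do 2!apply: dvdp_mull.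
(* Since [h = 0], (j - i) g_j = 0 for all j, and distinct exponents below p stay distinct in [F].
   The remaining monomial does not vanish at 1. *)
have gE : g = g`_i *: 'X^i.
  apply/polyP=> j; rewrite coefZ coefXn.
  have [->|ji] := eqVneq j i; rewrite ?mulr1 // mulr0.
  have [lt_jp|le_pj] := ltnP j p; last by rewrite nth_default ?(leq_trans sz_g).
  have /eqP := coef_h j; rewrite h0 coef0 eq_sym mulf_eq0 => /orP[|/eqP//].
  rewrite subr_eq0 (eqr_natr_pchar _ _ pcharF) !modn_small // => /eqP Eji.
  by rewrite Eji eqxx in ji.
have : root g 1 by rewrite -dvdp_XsubCl (dvdp_trans _ dv_g) // exprS dvdp_mulr.
by rewrite gE rootE !hornerE expr1n mulr1 [_ == 0](negbTE gi).
Qed.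

(** * Newton interpolation *)

(* The coefficients of X^a in the Newton basis \prod_(l < j) (X - z_l), from
   X * \prod_(l < j) (X - z_l)
     = \prod_(l < j.+1) (X - z_l) + z_j * \prod_(l < j) (X - z_l). *)
Fixpoint newton (A : comNzRingType) (z : nat -> A) (a j : nat) : A :=
  if a is a'.+1 then
    (if j is j'.+1 then newton z a' j' else 0) + z j * newton z a' j
  else (j == 0%N)%:R.

Lemma newton_gt (A : comNzRingType) (z : nat -> A) a j :
  (a < j)%N -> newton z a j = 0.
Proof.
elim: a j => [|a IHa] [|j] //= lt_aj.
by rewrite !IHa ?mulr0 ?addr0 // ltnW.
Qed.

Lemma rmorph_newton (A B : comNzRingType) (h : {rmorphism A -> B}) z a j :
  h (newton z a j) = newton (h \o z) a j.
Proof.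
elim: a j => [|a IHa] j /=; first by rewrite rmorph_nat.
by rewrite rmorphD rmorphM /= IHa; case: j => [|j]; rewrite ?rmorph0 ?IHa.
Qed.

Lemma eq_newton (A : comNzRingType) (z z' : nat -> A) a j :
  z =1 z' -> newton z a j = newton z' a j.
Proof.
move=> eq_z; elim: a j => [|a IHa] j //=.
by rewrite eq_z IHa; case: j => [|j] //; rewrite IHa.
Qed.

Definition newton_poly (A : comNzRingType) (z : nat -> A) j : {poly A} :=
  \prod_(l < j) ('X - (z l)%:P).

Lemma expX_newton (A : comNzRingType) (z : nat -> A) a n :
  (a < n)%N -> 'X^a = \sum_(j < n) newton z a j *: newton_poly z j.
Proof.
elim: a n => [|a IHa] [|n] //= lt_an.
  rewrite big_ord_recl /newton_poly big_ord0 scale1r big1 ?addr0 // => i _.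
  by rewrite scale0r.
rewrite exprS (IHa n) // mulr_sumr.
under [RHS]eq_bigr do rewrite scalerDl.
(* The shifted sum loses its term j = 0 and the other one its last term, so both run over ['I_n]. *)
rewrite big_split /= [X in X + _]big_ord_recl scale0r add0r.
rewrite [X in _ + X]big_ord_recr /= newton_gt // mulr0 scale0r addr0.
rewrite -big_split /=; apply: eq_bigr => j _.
rewrite /newton_poly big_ord_recr /= -scalerAr [z j * _]mulrC -scalerA.
rewrite -scalerDr; congr (_ *: _).
by rewrite -mul_polyC mulrBr [_%:P * _]mulrC subrK mulrC.
Qed.

(** The divided difference of [q] at [z 0, ..., z j] when [size q <= n], written so as to be visibly
    linear in the coefficients of [q]. *)
Definition newton_coef (A : comNzRingType) (z : nat -> A) n (q : {poly A}) j :=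
  \sum_(i < n) q`_i * newton z i j.

Lemma poly_newton (A : comNzRingType) (z : nat -> A) n (q : {poly A}) :
  (size q <= n)%N ->
  q = \sum_(j < n) newton_coef z n q j *: newton_poly z j.
Proof.
move=> sz_q; rewrite -[LHS]coefK poly_def.
rewrite (big_ord_widen n (fun i => q`_i *: 'X^i)) // big_mkcond /=.
transitivity
  (\sum_(i < n) \sum_(j < n) (q`_i * newton z i j) *: newton_poly z j).
  apply: eq_bigr => i _; rewrite (expX_newton z (ltn_ord i)) scaler_sumr.
  case: ltnP => [_|le_qi]; first by apply: eq_bigr => j _; rewrite scalerA.
  by rewrite big1 // => j _; rewrite nth_default // mul0r scale0r.
by rewrite exchange_big; apply: eq_bigr => j _; rewrite scaler_suml.
Qed.

(** The system is triangular: at [z j] the basis polynomials of index above j vanish, the earlier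
    coefficients are 0 by induction, and [newton_poly z j] is nonzero there because the nodes are
    distinct. *)
Lemma newton_coef_eq0 (A : idomainType) (z : nat -> A) n (q : {poly A}) k :
  (size q <= n)%N -> {in gtn k &, injective z} ->
  (forall j, (j < k)%N -> root q (z j)) ->
  forall j, (j < k)%N -> (j < n)%N -> newton_coef z n q j = 0.
Proof.
move=> sz_q inj_z qz; elim/ltn_ind=> j IHj lt_jk lt_jn.
have /eqP := qz j lt_jk.
rewrite [in q.[_]](poly_newton z sz_q) horner_sum => /eqP.
rewrite (bigD1 (Ordinal lt_jn)) //= big1 => [|i ij].
  rewrite addr0 hornerZ mulf_eq0 => /orP[/eqP //|].
  rewrite /newton_poly horner_prod => /prodf_eq0[l _].
  rewrite !hornerE subr_eq0 => /eqP/inj_z.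
  move=> Ejl; move: (ltn_ord l); rewrite -Ejl ?ltnn // inE //=.
  exact: ltn_trans lt_jk.
rewrite hornerZ; have [lt_ij|] := ltnP i j.
  by rewrite IHj ?mul0r // (ltn_trans lt_ij).
rewrite leq_eqVlt eq_sym => /orP[ji|lt_ji].
  by rewrite -val_eqE /= ji in ij.
rewrite /newton_poly horner_prod (bigD1 (Ordinal lt_ji)) //= hornerXsubC subrr.
by rewrite mul0r mulr0.
Qed.

(** * Chebotarev's theorem for p-th roots of unity *)

Lemma sparse_unity_roots (C : numFieldType) (p : nat) (zeta : C)
    (q : {poly C}) (rs : seq C) :
  prime p -> p.-primitive_root zeta -> q != 0 -> (size q <= p)%N ->
  uniq rs -> all p.-unity_root rs -> all (root q) rs ->
  (size rs < #|[set i : 'I_p | (q`_i != 0)%R]|)%N.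
Proof.
move=> p_pr prim_zeta q0 sz_q uniq_rs rs1 rs_q; rewrite ltnNge; apply/negP.
set S := [set i : 'I_p | _]; set k := #|S| => le_k_rs.
have le_kp : (k <= p)%N by rewrite -[p]card_ord max_card.
have [bs Drs] : exists bs : seq nat, rs = [seq zeta ^+ b | b <- bs].
  elim: rs {uniq_rs rs_q le_k_rs} rs1 => [|r rs IHrs] /=; first by exists nil.
  case/andP=> /unity_rootP/(prim_rootP prim_zeta)[b ->] /IHrs[bs ->].
  by exists (nat_of_ord b :: bs).
(* The ring is a parameter, so that one matrix serves at ['X] over the integers, at [zeta] in [C]
   and at 1 in ['F_p]. Past the end of [bs] the default exponent 0 gives the node 1. *)
pose z (A : comNzRingType) (x : A) l := x ^+ nth 0%N bs l.
pose M (A : comNzRingType) (x : A) : 'M[A]_k :=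
  \matrix_(i, j) newton (z A x) (@enum_val _ (mem S) i) j.
pose E := \det (M {poly int} 'X).
have evalE (A : comNzRingType) (x : A) : (map_poly intr E).[x] = \det (M A x).
  pose h : {rmorphism {poly int} -> A} := horner_eval x \o map_poly intr.
  have -> : (map_poly intr E).[x] = h E by [].
  rewrite -det_map_mx; congr (\det _); apply/matrixP=> i j.
  rewrite !mxE rmorph_newton.
  by apply: eq_newton => l; rewrite /z /= map_polyXn /horner_eval hornerXn.
have sz_bs : size bs = size rs by rewrite Drs size_map.
have zC l : (l < k)%N -> z C zeta l = rs`_l.
  by move=> lt_lk; rewrite Drs (nth_map 0%N) // sz_bs (leq_trans lt_lk).
have in_rs l : (l < k)%N -> (l < size rs)%N by move/leq_trans; apply.
have detC0 : \det (M C zeta) = 0.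
  (* The kernel vector consists of the nonzero coefficients of [q]. *)
  apply/eqP/det0P; exists (\row_i q`_(@enum_val _ (mem S) i)).
    apply/eqP=> /rowP row0.
    have [i Si] : exists i, i \in S.
      apply/existsP; apply: contraNT q0; rewrite negb_exists => /forallP qi0.
      apply/eqP/polyP=> i; rewrite coef0.
      have [lt_ip|le_pi] := ltnP i p; last first.
        by rewrite nth_default ?(leq_trans sz_q).
      by have := qi0 (Ordinal lt_ip); rewrite inE negbK => /eqP.
    have := row0 (enum_rank_in Si i).
    by rewrite !mxE enum_rankK_in //; move: Si; rewrite inE => /eqP.
  apply/rowP=> j; rewrite !mxE.
  transitivity (newton_coef (z C zeta) p q j).
    rewrite /newton_coef (bigID (mem S)) /= [X in _ = _ + X]big1 ?addr0 => [|i].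
      by rewrite [RHS]big_enum_val; apply: eq_bigr => i _; rewrite !mxE.
    by rewrite inE negbK => /eqP->; rewrite mul0r.
  apply: (@newton_coef_eq0 _ _ _ _ k) => //.
  - move=> l m /= lt_lk lt_mk; rewrite !zC // => /eqP.
    by rewrite nth_uniq ?in_rs // => /eqP.
  - by move=> l lt_lk; rewrite zC // (allP rs_q) // mem_nth ?in_rs.
  - exact: leq_trans le_kp.
have : root (map_poly intr E : {poly 'F_p}) 1.
  apply: (Fp_root1_of_root_unity p_pr (prim_expr_order prim_zeta)).
  by rewrite rootE evalE detC0.
rewrite rootE evalE => /det0P[v v0 vM].
pose g : {poly 'F_p} := \sum_(i < k) v 0 i *: 'X^(@enum_val _ (mem S) i).
have coef_g (a : 'I_p) : g`_a = \sum_(i < k | @enum_val _ (mem S) i == a) v 0 i.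
  rewrite coef_sum [RHS]big_mkcond; apply: eq_bigr => i _.
  by rewrite coefZ coefXn -val_eqE eq_sym; case: eqP; rewrite ?mulr1 ?mulr0.
have sz_g : (size g <= p)%N.
  apply: (leq_trans (size_sum _ _ _)); apply/bigmax_leqP=> i _.
  by rewrite (leq_trans (size_scale_leq _ _)) // size_polyXn.
have g0 : g = 0.
  apply: (@sparse_XsubC1_exp _ p k); rewrite ?pchar_Fp //.
    apply/subset_leq_card/subsetP=> a; rewrite inE coef_g; apply: contraR => Sa.
    by rewrite big1 // => i /eqP Eia; rewrite -Eia enum_valP in Sa.
  (* All nodes are 1, so [newton_poly] of index j is (X - 1)^j. The coefficients of index below k
     vanish by [vM], and the other terms are divisible by (X - 1)^k. *)
  rewrite (poly_newton (z 'F_p 1) sz_g); apply: (big_ind (dvdp _)).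
  - exact: dvdp0.
  - by move=> ? ?; apply: dvdp_add.
  move=> j _; have [lt_jk|le_kj] := ltnP j k.
    suff -> : newton_coef (z 'F_p 1) p g j = 0 by rewrite scale0r dvdp0.
    have /rowP/(_ (Ordinal lt_jk)) := vM; rewrite !mxE => <-.
    rewrite /newton_coef; under eq_bigr do rewrite coef_g mulr_suml.
    rewrite (exchange_big_dep predT) //=; apply: eq_bigr => i _.
    rewrite (big_pred1 (@enum_val _ (mem S) i)) => [|a]; last exact: eq_sym.
    by rewrite !mxE.
  rewrite -mul_polyC dvdp_mull // /newton_poly.
  under eq_bigr do rewrite /z expr1n.
  by rewrite prodr_const card_ord dvdp_exp2l.
case/eqP: v0; apply/rowP=> i; rewrite mxE.
have := coef_g (@enum_val _ (mem S) i); rewrite g0 coef0 (big_pred1 i) // => j.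
by rewrite (inj_eq enum_val_inj).
Qed.

(** * Characters of a cyclic group as roots of unity *)

Lemma expg_ord_bij (p : nat) (G : finGroupType) (alpha : G) :
  #|G| = p -> [set: G] = <[alpha]>%g ->
  bijective (fun i : 'I_p => (alpha ^+ i)%g).
Proof.
move=> cardG genG; have oa : #[alpha]%g = p by rewrite /order -genG cardsT.
apply: inj_card_bij => [i j /eqP|]; last by rewrite card_ord cardG.
by rewrite eq_expg_mod_order oa !modn_small // => /eqP/val_inj.
Qed.

Section CyclicFourier.
Variables (C : numClosedFieldType) (p : nat) (G : finGroupType) (alpha : G).
Hypotheses (cardG : #|G| = p) (genG : [set: G] = <[alpha]>%g).

Let order_alpha : #[alpha]%g = p.
Proof. by rewrite /order -genG cardsT. Qed.

Let p_gt0 : (0 < p)%N.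
Proof. by rewrite -order_alpha order_gt0. Qed.

Lemma dual_alpha_unity (psi : dual C G) : psi alpha ^+ p = 1.
Proof. by rewrite -dualX -order_alpha expg_order dual1. Qed.

Lemma dual_alpha_inj : injective (fun psi : dual C G => psi alpha).
Proof.
have [log _ logK] := expg_ord_bij cardG genG.
move=> psi phi /= eq_alpha; apply/val_inj/ffunP=> x.
have : psi x = phi x by rewrite -(logK x) !dualX eq_alpha.
by [].
Qed.

Lemma dual_alpha_surj (r : C) :
  r ^+ p = 1 -> exists psi : dual C G, psi alpha = r.
Proof.
move=> rp1; have [log expK logK] := expg_ord_bij cardG genG.
(* Here [log] is additive only modulo p, which suffices since powers of [r] depend on the exponent
   modulo p. *)
have eq_r i j : (alpha ^+ i = alpha ^+ j)%g -> r ^+ i = r ^+ j.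
  move/eqP; rewrite eq_expg_mod_order order_alpha => /eqP eq_ij.
  by rewrite -(expr_mod i rp1) eq_ij expr_mod.
have hom_psi : is_hom [ffun x => r ^+ log x].
  apply/andP; split; apply/forallP=> x.
    rewrite ffunE expf_eq0 negb_and; apply/orP; right.
    apply: contraTneq (oner_neq0 C) => r0.
    by rewrite -rp1 r0 expr0n (gtn_eqF p_gt0) eqxx.
  apply/forallP=> y; rewrite !ffunE -exprD.
  by apply/eqP/eq_r; rewrite expgD !logK.
exists (Dual hom_psi); rewrite /dual_fun /= ffunE.
by rewrite -[RHS]expr1; apply: eq_r; rewrite logK.
Qed.

(** Evaluation at [alpha] is a bijection from characters to p-th roots of unity, and X^p - 1 is
    separable in characteristic 0. *)
Lemma prod_dual_alpha : \prod_(psi : dual C G) ('X - (psi alpha)%:P) = 'X^p - 1.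
Proof.
have [rs] := closed_field_poly_normal ('X^p - 1 : {poly C}).
rewrite (monicP (monic_Xn_sub_1 _ p_gt0)) scale1r => Drs.
rewrite Drs -(big_image _ _ (fun psi : dual C G => psi alpha) predT
  (fun r => 'X - r%:P)) /=.
apply: perm_big; apply: uniq_perm => [||r].
- by rewrite map_inj_uniq ?enum_uniq //; apply: dual_alpha_inj.
- by rewrite -separable_prod_XsubC -Drs separable_Xn_sub_1 // pnatr_eq0 -lt0n.
rewrite -[r \in rs]root_prod_XsubC -Drs; apply/imageP/idP=> [[psi _ ->]|].
  by rewrite rootE !hornerE dual_alpha_unity subrr.
by rewrite rootE !hornerE subr_eq0 => /eqP/dual_alpha_surj[psi <-]; exists psi.
Qed.

Lemma card_dual : #|{: dual C G}| = p.
Proof.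
have /(congr1 (fun q : {poly C} => size q)) := prod_dual_alpha.
rewrite -big_filter size_prod_XsubC size_Xn_sub_1 // => -[<-].
by case: big_enumP => e _ _ [_ ->].
Qed.

Lemma coef_genpoly (f : {ffun G -> C}) (i : 'I_p) :
  (genpoly p alpha f)`_i = f (alpha ^+ i)%g.
Proof.
rewrite coef_sum (bigD1 i) //= coefZ coefXn eqxx mulr1 big1 ?addr0 // => j ji.
by rewrite coefZ coefXn eq_sym val_eqE (negbTE ji) mulr0.
Qed.

Lemma size_genpoly (f : {ffun G -> C}) : (size (genpoly p alpha f) <= p)%N.
Proof.
apply: (leq_trans (size_sum _ _ _)); apply/bigmax_leqP=> i _.
by rewrite (leq_trans (size_scale_leq _ _)) // size_polyXn.
Qed.

Lemma card_support_genpoly (f : {ffun G -> C}) :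
  #|[set i : 'I_p | ((genpoly p alpha f)`_i != 0)%R]| = #|support f|.
Proof.
rewrite -!sum1_card (reindex _ (onW_bij _ (expg_ord_bij cardG genG))) /=.
by apply: eq_bigl => i; rewrite inE coef_genpoly.
Qed.

Lemma fourierE (f : {ffun G -> C}) (psi : dual C G) :
  fourier f psi = (genpoly p alpha f).[psi alpha].
Proof.
rewrite ffunE (reindex _ (onW_bij _ (expg_ord_bij cardG genG))) horner_sum /=.
by apply: eq_bigr => i _; rewrite !hornerE dualX.
Qed.

(** Split X^p - 1 into its factors X - psi(alpha): those with [fourier f psi != 0] are coprime to
    the generating polynomial, and the product of the others divides it. *)
Lemma size_gcd_genpoly (f : {ffun G -> C}) :
  size (gcdp (genpoly p alpha f) ('X^p - 1)) =
    #|[pred psi | fourier f psi == 0]|.+1.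
Proof.
rewrite -prod_dual_alpha (bigID [pred psi | fourier f psi == 0]) /=.
rewrite (eqp_size (Gauss_gcdpl _ _)); last first.
  apply: (big_ind (coprimep _)) => [|u v|psi psi_nz]; first exact: coprimep1.
    by rewrite coprimepMr => ->.
  by rewrite coprimep_XsubC rootE -fourierE.
set A := \prod_(psi | _) _; rewrite (eqp_size (q := A)).
  by rewrite /A -big_filter size_prod_XsubC; case: big_enumP => e _ _ [_ ->].
apply: dvdp_gcd_idr.
rewrite /A -(big_image _ _ (fun psi : dual C G => psi alpha)
  [pred psi | fourier f psi == 0] (fun r => 'X - r%:P)).
apply: uniq_roots_dvdp.
  by apply/allP=> r /imageP[psi psi0 ->]; rewrite rootE -fourierE.
rewrite uniq_rootsE map_inj_uniq ?enum_uniq //; exact: dual_alpha_inj.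
Qed.

End CyclicFourier.

(** * The inequality and its equality case *)

Theorem theorem3p25 (R : realType) (p : nat) (G : finGroupType) (alpha : G)
    (f : {ffun G -> R[i]}) :
  prime p -> #|G| = p -> [set: G] = <[alpha]>%g -> f != 0 ->
  (p + 1 <= #|support f| + #|support (fourier f)|)%N /\
  ((#|support f| + #|support (fourier f)|)%N = (p + 1)%N <->
   (size (gcdp (genpoly p alpha f) ('X^p - 1))).-1 = (#|support f| - 1)%N).
Proof.
move=> p_pr cardG genG f0; rewrite (size_gcd_genpoly cardG genG) /=.
set Z := [pred psi | _].
have cardZ : (#|Z| + #|support (fourier f)|)%N = p.
  rewrite -[RHS](card_dual R[i] cardG genG) -(cardC Z); congr (_ + _)%N.
have lt_Z : (#|Z| < #|support f|)%N.
  pose Q (s : pred (dual R[i] G)) :=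
    image (fun psi : dual R[i] G => psi alpha) s.
  have uniqQ s : uniq (Q s).
    by rewrite map_inj_uniq ?enum_uniq //; apply: dual_alpha_inj cardG genG.
  have Q1 s : all p.-unity_root (Q s).
    apply/allP=> r /imageP[psi _ ->]; apply/unity_rootP.
    exact: dual_alpha_unity.
  have sz_Q : (p <= size (Q predT))%N.
    by rewrite size_image (card_dual _ cardG genG).
  (* The p distinct values psi(alpha) must include a primitive p-th root of unity. *)
  have /hasP[zeta _ prim_zeta] :=
    has_prim_root (prime_gt0 p_pr) (Q1 predT) (uniqQ predT) sz_Q.
  have -> : #|Z| = size (Q Z) by rewrite size_image.
  rewrite -(card_support_genpoly cardG genG).
  apply: (sparse_unity_roots p_pr prim_zeta) => //.
  - apply: contraNneq f0 => g0; apply/eqP/ffunP=> x; rewrite ffunE.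
    have [log _ logK] := expg_ord_bij cardG genG.
    by rewrite -(logK x) -coef_genpoly g0 coef0.
  - exact: size_genpoly.
  by apply/allP=> r /imageP[psi psi0 ->]; rewrite rootE -fourierE.
(* Substituting [cardZ] for p reduces the bound to [lt_Z] and equality to |Z| + 1 = |supp f|; [lt_Z]
   also makes |supp f| positive, so the truncated subtraction is exact. *)
rewrite -cardZ addnAC addn1 leq_add2r; split=> //.
case: #|support f| lt_Z => // s _; rewrite subn1.
by split=> [/addIn[] | ->].
Qed.
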